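(* The general term $t(n,k)$ ($n,k\ge0$) of the Riordan array $(1 + zM(z), z(1 + zM(z)))$ is given by $$t(n,k)=\begin{cases} 1& \text{if } n=k,\\ \displaystyle\frac{k+1}{n-k}\sum_{j=0}^k\binom{k}{j}\sum_{i=0}^{n-k}\binom{n-k}{i}\binom{i}{n-k-i-j-1}&\text{otherwise.} \end{cases}$$
   Context: $M(z)=\frac{1-z-\sqrt{1-2z-3z^2}}{2z^2}$ is the generating function of the Motzkin numbers. For formal power series $g,f$ with $g(0)\ne0$, $f(0)=0$, $f'(0)\neq0$, the Riordan array $(g(z),f(z))$ is the infinite lower triangular matrix whose $k$-th column ($k\ge0$) has generating function $g(z)f(z)^k$; its general term is $t(n,k)=[z^n]g(z)f(z)^k$. Conventions: $\binom{a}{b}=0$ if $b<0$ or $b>a\ge0$; empty sums are $0$. *)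

(* Defs.v *)
From HB Require Import structures.
From mathcomp Require Import all_boot all_order all_algebra.
From mathcomp Require Import boolp.

Set Implicit Arguments.
Unset Strict Implicit.
Unset Printing Implicit Defensive.

Import GRing.Theory.
Local Open Scope ring_scope.

Record fps (R : Type) := Fps { fcoef : nat -> R }.

Reserved Notation "f `[z^ n ]" (at level 1, n at level 200, format "f `[z^ n ]").
Notation "f `[z^ n ]" := (fcoef f n) : ring_scope.

Lemma fpsP (R : Type) (f g : fps R) :
  (forall n, f`[z^n] = g`[z^n]) <-> f = g.
Proof.
split=> [|-> //]; case: f g => [f] [g] /= fg.
by congr Fps; apply: funext.
Qed.

HB.instance Definition _ (R : Type) := gen_eqMixin (fps R).
HB.instance Definition _ (R : Type) := gen_choiceMixin (fps R).

Section FpsRing.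
Variable R : comNzRingType.
Implicit Types (f g h : fps R) (n : nat).

Definition fps_const (c : R) : fps R := Fps (fun n => if n == 0%N then c else 0).
Definition fps_add f g : fps R := Fps (fun n => f`[z^n] + g`[z^n]).
Definition fps_opp f : fps R := Fps (fun n => - f`[z^n]).
Definition fps_mul f g : fps R :=
  Fps (fun n => \sum_(i < n.+1) f`[z^i] * g`[z^(n - i)]).

Definition fps_trunc N f : {poly R} := \poly_(i < N) f`[z^i].

Lemma coef_fps_trunc N f n : (n < N)%N -> (fps_trunc N f)`_n = f`[z^n].
Proof. by move=> ltnN; rewrite coef_poly ltnN. Qed.

Lemma fps_mul_trunc N f g n : (n < N)%N ->
  (fps_mul f g)`[z^n] = (fps_trunc N f * fps_trunc N g)`_n.
Proof.
move=> ltnN; rewrite coefM; apply: eq_bigr => i _.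
have lein : (i <= n)%N by rewrite -ltnS ltn_ord.
by rewrite !coef_fps_trunc ?(leq_ltn_trans _ ltnN) ?leq_subr.
Qed.

Fact fps_addA : associative fps_add.
Proof. by move=> f g h; apply/fpsP => n /=; rewrite addrA. Qed.

Fact fps_addC : commutative fps_add.
Proof. by move=> f g; apply/fpsP => n /=; rewrite addrC. Qed.

Fact fps_add0 : left_id (fps_const 0) fps_add.
Proof. by move=> f; apply/fpsP => n /=; case: ifP => _; rewrite add0r. Qed.

Fact fps_addN : left_inverse (fps_const 0) fps_opp fps_add.
Proof. by move=> f; apply/fpsP => n /=; case: ifP => _; rewrite addNr. Qed.

HB.instance Definition _ :=
  GRing.isZmodule.Build (fps R) fps_addA fps_addC fps_add0 fps_addN.

Fact fps_mulC : commutative fps_mul.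
Proof.
by move=> f g; apply/fpsP => n; rewrite !(@fps_mul_trunc n.+1) // mulrC.
Qed.

Fact fps_mulA : associative fps_mul.
Proof.
move=> f g h; apply/fpsP => n.
have le i : (n - i < n.+1)%N by rewrite ltnS leq_subr.
transitivity ((fps_trunc n.+1 f * (fps_trunc n.+1 g * fps_trunc n.+1 h))`_n).
  rewrite coefM; apply: eq_bigr => i _.
  by rewrite coef_fps_trunc // (@fps_mul_trunc n.+1) ?le.
rewrite mulrA coefM; apply: eq_bigr => i _.
by rewrite coef_fps_trunc ?le // (@fps_mul_trunc n.+1).
Qed.

Fact fps_mul1 : left_id (fps_const 1) fps_mul.
Proof.
move=> f; apply/fpsP => n /=; rewrite big_ord_recl /= mul1r subn0.
by rewrite big1 ?addr0 // => i _; rewrite mul0r.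
Qed.

Fact fps_mulDl : left_distributive fps_mul fps_add.
Proof.
move=> f g h; apply/fpsP => n /=; rewrite -big_split /=.
by apply: eq_bigr => i _; rewrite mulrDl.
Qed.

Fact fps_oner_neq0 : fps_const 1 != 0.
Proof.
apply/eqP => /(congr1 (fun f => f`[z^0])) /= /eqP.
by rewrite oner_eq0.
Qed.

HB.instance Definition _ := GRing.Zmodule_isComNzRing.Build (fps R)
  fps_mulA fps_mulC fps_mul1 fps_mulDl fps_oner_neq0.

Definition fps_Z : fps R := Fps (fun n => (n == 1%N)%:R).

(* Quotient by z^d, meaningful for series divisible by z^d. *)
Definition fps_shift d f : fps R := Fps (fun n => f`[z^(n + d)]).

Lemma coef_fpsD f g n : (f + g)`[z^n] = f`[z^n] + g`[z^n].
Proof. by []. Qed.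

Lemma coef_fpsN f n : (- f)`[z^n] = - f`[z^n].
Proof. by []. Qed.

Lemma coef_fps0 n : (0 : fps R)`[z^n] = 0.
Proof. by rewrite /=; case: ifP. Qed.

Lemma coef_fps1 n : (1 : fps R)`[z^n] = (n == 0%N)%:R.
Proof. by rewrite /=; case: ifP. Qed.

Lemma coef_fpsM f g n :
  (f * g)`[z^n] = \sum_(i < n.+1) f`[z^i] * g`[z^(n - i)].
Proof. by []. Qed.

Lemma coef_fpsMn f m n : (f *+ m)`[z^n] = f`[z^n] *+ m.
Proof.
by elim: m => [|m IHm]; rewrite ?mulr0n ?coef_fps0 // !mulrS coef_fpsD IHm.
Qed.

Lemma coef_fpsCM c f n : (fps_const c * f)`[z^n] = c * f`[z^n].
Proof.
rewrite coef_fpsM big_ord_recl /= subn0 big1 ?addr0 // => i _.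
by rewrite mul0r.
Qed.

Lemma coef_fpsZM f n :
  (fps_Z * f)`[z^n] = if n is m.+1 then f`[z^m] else 0.
Proof.
rewrite coef_fpsM big_ord_recl /= mul0r add0r.
case: n => [|n]; first by rewrite big_ord0.
rewrite big_ord_recl /= mul1r subSS subn0 big1 ?addr0 // => i _.
by rewrite mul0r.
Qed.

(* [riordan_pair g f] is the condition under which (g, f) defines a Riordan
   array; [riordan_term g f n k] is the entry in row n and column k. *)
Definition riordan_pair g f : Prop :=
  [/\ g`[z^0] != 0, f`[z^0] = 0 & f`[z^1] != 0].

Definition riordan_term g f (n k : nat) : R := (g * f ^+ k)`[z^n].

End FpsRing.

Notation "''z'" := (fps_Z _) (at level 0) : ring_scope.

Section FpsSqrt.
Variable F : fieldType.

(* The first n coefficients of the square root s of a series a with constant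
   term 1, normalised by s(0) = 1: comparing coefficients of z^m in s * s = a
   gives 2 s_m + \sum_(1 <= i < m) s_i s_(m-i) = a_m for m > 0. *)
Fixpoint fps_sqrt_coefs (a : fps F) (n : nat) : seq F :=
  if n is m.+1 then
    let s := fps_sqrt_coefs a m in
    rcons s (if m == 0%N then 1
             else (a`[z^m] - \sum_(1 <= i < m) s`_i * s`_(m - i)) / 2)
  else [::].

Definition fps_sqrt (a : fps F) : fps F :=
  Fps (fun n => (fps_sqrt_coefs a n.+1)`_n).

Lemma size_fps_sqrt_coefs a n : size (fps_sqrt_coefs a n) = n.
Proof. by elim: n => //= n IHn; rewrite size_rcons IHn. Qed.

Lemma nth_fps_sqrt_coefs a n i : (i < n)%N ->
  (fps_sqrt_coefs a n)`_i = (fps_sqrt a)`[z^i].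
Proof.
elim: n => // n IHn; rewrite ltnS leq_eqVlt => /predU1P[-> //|ltin].
by rewrite -IHn //= nth_rcons size_fps_sqrt_coefs ltin.
Qed.

Lemma coef_fps_sqrt0 a : (fps_sqrt a)`[z^0] = 1.
Proof. by []. Qed.

Lemma coef_fps_sqrtS a n : (fps_sqrt a)`[z^n.+1] =
  (a`[z^n.+1] - \sum_(1 <= i < n.+1)
     (fps_sqrt a)`[z^i] * (fps_sqrt a)`[z^(n.+1 - i)]) / 2.
Proof.
rewrite {1}/fps_sqrt [LHS]/= nth_rcons size_rcons size_fps_sqrt_coefs.
rewrite ltnn eqxx; congr ((_ - _) / _); apply: eq_big_nat => i /andP[i0 lein].
rewrite -[rcons _ _]/(fps_sqrt_coefs a n.+1).
rewrite !nth_fps_sqrt_coefs //.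
by rewrite ltnS leq_subLR -add1n leq_add2r.
Qed.

Lemma fps_sqrtP (a : fps F) : (2 : F) != 0 -> a`[z^0] = 1 ->
  fps_sqrt a ^+ 2 = a.
Proof.
move=> nz2 a0; apply/fpsP => -[|n]; rewrite expr2 coef_fpsM.
  by rewrite big_ord1 !coef_fps_sqrt0 mulr1 a0.
rewrite -(big_mkord xpredT (fun i =>
  (fps_sqrt a)`[z^i] * (fps_sqrt a)`[z^(n.+1 - i)])).
rewrite big_nat_recr // big_ltn // subnn subn0 coef_fps_sqrt0 mul1r mulr1.
rewrite [LHS]addrAC -mulr2n -mulr_natr coef_fps_sqrtS divfK //.
by rewrite subrK.
Qed.

End FpsSqrt.

(* M(z) = (1 - z - sqrt(1 - 2z - 3z^2)) / (2z^2) *)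
Definition motzkin : fps rat :=
  fps_const 2^-1 *
  fps_shift 2 (1 - 'z - fps_sqrt (1 - 2 * 'z - 3 * 'z ^+ 2)).

Lemma motzkin_disc0 : (1 - 2 * 'z - 3 * 'z ^+ 2 : fps rat)`[z^0] = 1.
Proof.
rewrite !mulr_natl expr2 !(coef_fpsD, coef_fpsN, coef_fpsMn) coef_fpsZM.
by rewrite coef_fps1.
Qed.

Lemma motzkin_sqrtP :
  fps_sqrt (1 - 2 * 'z - 3 * 'z ^+ 2) ^+ 2 = 1 - 2 * 'z - 3 * 'z ^+ 2 :> fps rat.
Proof. by apply: fps_sqrtP; rewrite ?motzkin_disc0. Qed.

Lemma motzkinP :
  2 * 'z ^+ 2 * motzkin = 1 - 'z - fps_sqrt (1 - 2 * 'z - 3 * 'z ^+ 2).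
Proof.
set s := fps_sqrt _.
have s0 : s`[z^0] = 1 by rewrite coef_fps_sqrt0.
have s1 : s`[z^1] = -1.
  rewrite coef_fps_sqrtS big_geq // subr0 !mulr_natl expr2.
  by rewrite !(coef_fpsD, coef_fpsN, coef_fpsMn) coef_fpsZM coef_fps1.
apply/fpsP => n; rewrite -mulrA mulr_natl coef_fpsMn expr2 -mulrA coef_fpsZM.
case: n => [|n].
  by rewrite !(coef_fpsD, coef_fpsN) coef_fps1 s0 /= subr0 subrr.
rewrite coef_fpsZM; case: n => [|n].
  by rewrite !(coef_fpsD, coef_fpsN) coef_fps1 s1.
rewrite /motzkin -/s coef_fpsCM -mulrnAl -[_ *+ 2]mulr_natl divff // mul1r.
by rewrite -[n.+2]addn2.
Qed.

Lemma motzkin_riordan_pair :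
  riordan_pair (1 + 'z * motzkin) ('z * (1 + 'z * motzkin)).
Proof.
have g0 : (1 + 'z * motzkin)`[z^0] = 1.
  by rewrite coef_fpsD coef_fpsZM coef_fps1 addr0.
by split; rewrite ?coef_fpsZM ?g0.
Qed.

(* The lower index is an integer so that n - k - i - j - 1 is the genuine,
   possibly negative, difference. *)
Definition binz (a : nat) (b : int) : nat := if b is Posz m then 'C(a, m) else 0.

(* Main.v *)
From HB Require Import structures.
Require Import Defs.
From mathcomp Require Import all_boot all_order all_algebra.
From mathcomp Require Import ring zify.

Import GRing.Theory.
Local Open Scope ring_scope.

(** Put [u = z M(z)]. The quadratic equation satisfied by the Motzkin series
    reads [u = z (1 + u + u^2)], so [u] is the compositional inverse of
    [w / (1 + w + w^2)] and the coefficients of any polynomial [H] in [u] are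
    given by Lagrange inversion ([lagrange_inversion]):
      [m [z^m] H(u) = [w^(m-1)] H'(w) (1 + w + w^2)^m]  for [m > 0].
    Column [k] of the array is [z^k (1 + u)^(k+1)]; so the entry in row [n]
    is [[z^(n-k)] H(u)] with [H = (1 + w)^(k+1)], and it equals
      [(k+1) / (n-k) [w^(n-k-1)] (1 + w)^k (1 + w + w^2)^(n-k)].
    Expanding [(1 + w)^k] and [(1 + w (1 + w))^(n-k)] by the binomial theorem
    gives the double sum: [j] is the exponent of [w] chosen in the first factor,
    [i] the exponent of [w (1 + w)] in the second, and
    [binom(i, n-k-i-j-1)] is the coefficient left to [(1 + w)^i]. *)

Lemma fps_const_is_zmod_morphism (R : comNzRingType) :
  zmod_morphism (@fps_const R).
Proof.
move=> a b; apply/fpsP => n; rewrite coef_fpsD coef_fpsN /=.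
by case: ifP => _; rewrite ?subrr.
Qed.

Lemma fps_const_is_monoid_morphism (R : comNzRingType) :
  monoid_morphism (@fps_const R).
Proof.
split=> // a b; apply/fpsP => n; rewrite coef_fpsCM /=.
by case: ifP; rewrite ?mulr0.
Qed.

HB.instance Definition _ (R : comNzRingType) :=
  GRing.isZmodMorphism.Build R (fps R) (@fps_const R)
    (@fps_const_is_zmod_morphism R).
HB.instance Definition _ (R : comNzRingType) :=
  GRing.isMonoidMorphism.Build R (fps R) (@fps_const R)
    (@fps_const_is_monoid_morphism R).

Definition fps_subst (R : comNzRingType) (H : {poly R}) (u : fps R) : fps R :=
  (map_poly (@fps_const R) H).[u].
Arguments fps_subst {R} H u.

Lemma fps_subst_MXaddC (R : comNzRingType) (Q : {poly R}) c u :
  fps_subst (Q * 'X + c%:P) u = fps_subst Q u * u + fps_const c.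
Proof. by rewrite /fps_subst rmorphD rmorphM /= map_polyX map_polyC !hornerE. Qed.

Lemma coef0_fps_subst (R : comNzRingType) (H : {poly R}) u :
  u`[z^0] = 0 -> (fps_subst H u)`[z^0] = H`_0.
Proof.
move=> u0; elim/poly_ind: H => [|Q c _].
  by rewrite /fps_subst rmorph0 horner0 coef_fps0 coef0.
rewrite fps_subst_MXaddC coef_fpsD coef_fpsM big_ord1 u0 mulr0 add0r.
by rewrite coefD coefMX coefC add0r.
Qed.

(** Induction on [n]. Writing [H = Q w + c], the equation for [u] turns
    [H(u)] into [c + z (Q phi)(u)], which lowers the exponent of [z] by one at
    the price of replacing [H] by [Q phi]. The induction hypothesis for [Q phi]
    is about [(Q phi)'], the claim about [H' = Q + w Q']; for [n > 0] they match
    because [n [w^n] P = [w^(n-1)] P'] with [P = Q phi^(n+1)]. *)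
Lemma lagrange_inversion (R : numDomainType) (phi H : {poly R}) (u : fps R) n :
  u = 'z * fps_subst phi u ->
  (fps_subst H u)`[z^n.+1] *+ n.+1 = (H^`() * phi ^+ n.+1)`_n.
Proof.
move=> uE; have u0 : u`[z^0] = 0 by rewrite uE coef_fpsZM.
elim: n H => [|n IHn] H; elim/poly_ind: H => [|Q c _];
  try by rewrite /fps_subst rmorph0 horner0 coef_fps0 mul0rn deriv0 mul0r coef0.
all: have step m :
    (fps_subst (Q * 'X + c%:P) u)`[z^m.+1] = (fps_subst (Q * phi) u)`[z^m]
  by rewrite fps_subst_MXaddC {2}uE mulrCA coef_fpsD coef_fpsZM /= addr0
             /fps_subst rmorphM hornerM.
all: rewrite step derivD derivC addr0 derivM derivX mulr1.
  rewrite coef0_fps_subst // mulrDl coefD expr1.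
  by rewrite -mulrA mulrCA coefXM add0r.
(* The induction hypothesis controls the coefficient of [z^(n+1)] only after
   multiplication by [n.+1]; cancelling this factor uses characteristic 0. *)
apply: (@mulIf _ n.+1%:R); first by rewrite Num.Theory.pnatr_eq0.
rewrite !mulr_natr -mulrnA mulnC mulrnA {}IHn.
have -> : ((Q^`() * 'X + Q) * phi ^+ n.+2)`_n.+1 =
          (Q^`() * phi ^+ n.+2)`_n + (Q * phi ^+ n.+2)`_n.+1.
  by rewrite mulrDl coefD -mulrA mulrCA coefXM.
rewrite mulrnDl -[in X in _ + X]coef_deriv -!coefMn -!coefD.
congr ((_ : {poly R})`_n); rewrite !(derivM Q) deriv_exp /=.
by rewrite mulrDl mulrnDl [RHS]addrA -mulrSr (exprS phi n.+1) mulrnAr !mulrA.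
Qed.

Lemma coef_add1X (R : comNzRingType) i b :
  ((1 + 'X : {poly R}) ^+ i)`_b = 'C(i, b)%:R.
Proof.
rewrite exprDn coef_sum.
under eq_bigr => j _ do rewrite expr1n mul1r coefMn coefXn.
have [ltbi|ltib] := ltnP b i.+1.
  rewrite (bigD1 (Ordinal ltbi)) //= eqxx big1 ?addr0 // => j.
  by rewrite -val_eqE /= eq_sym => /negbTE->; rewrite mul0rn.
rewrite bin_small // big1 // => j _.
by rewrite gtn_eqF ?mul0rn // (leq_trans (ltn_ord j)).
Qed.

(** [binz] vanishes at negative lower index, just as the coefficients of a
    multiple of ['X^d] do below degree [d]; this absorbs all case distinctions
    of the double expansion. *)
Lemma coefXnM_add1X (R : comNzRingType) d i b :
  ('X^d * (1 + 'X : {poly R}) ^+ i)`_b = (binz i (b%:Z - d%:Z))%:R.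
Proof.
rewrite coefXnM coef_add1X; case: ltnP => [ltbd|ledb].
  have: (b%:Z - d%:Z < 0)%R by lia.
  by case: (b%:Z - d%:Z).
by rewrite subzn.
Qed.

Lemma coef_add1X_trinomial (R : comNzRingType) k m b :
  ((1 + 'X : {poly R}) ^+ k * (1 + 'X + 'X ^+ 2) ^+ m)`_b =
  \sum_(0 <= j < k.+1) 'C(k, j)%:R *
    \sum_(0 <= i < m.+1) 'C(m, i)%:R * (binz i (b%:Z - i%:Z - j%:Z))%:R.
Proof.
have -> : 1 + 'X + 'X ^+ 2 = 1 + 'X * (1 + 'X) :> {poly R} by ring.
rewrite exprDn mulr_suml coef_sum big_mkord; apply: eq_bigr => j _.
rewrite [in LHS]mulrnAl coefMn mulr_natl; congr (_ *+ _).
rewrite expr1n mul1r exprDn mulr_sumr coef_sum big_mkord; apply: eq_bigr => i _.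
rewrite expr1n mul1r [in LHS]mulrnAr coefMn mulr_natl exprMn mulrA -exprD.
by rewrite coefXnM_add1X; congr (_%:R *+ _); congr binz; lia.
Qed.

Lemma fps_Z_lreg (R : comNzRingType) : GRing.lreg ('z : fps R).
Proof.
move=> f g /fpsP eqfg; apply/fpsP => n.
by have := eqfg n.+1; rewrite !coef_fpsZM.
Qed.

Lemma coef_fpsZnM (R : comNzRingType) k (f : fps R) n :
  ('z ^+ k * f)`[z^n] = if (n < k)%N then 0 else f`[z^(n - k)].
Proof.
elim: k n => [|k IHk] n; first by rewrite expr0 mul1r subn0.
by rewrite exprS -mulrA coef_fpsZM; case: n => [|n] //; rewrite IHk.
Qed.

(** Squaring the definition of [motzkin] removes the square root; what remains
    is this equation multiplied by [4 z], a regular element. *)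
Lemma motzkin_quadratic (u := 'z * motzkin) : u = 'z * (1 + u + u ^+ 2).
Proof.
have sE : fps_sqrt (1 - 2 * 'z - 3 * 'z ^+ 2) = 1 - 'z - 2 * 'z * u :> fps rat.
  have := motzkinP; rewrite /u; set s := fps_sqrt _ => sE.
  by rewrite -mulrA mulrA mulrA -(mulrA 2) -expr2 sE; ring.
have := motzkin_sqrtP; rewrite sE => eqs.
have : 'z * (u *+ 4) = 'z * (('z * (1 + u + u ^+ 2)) *+ 4).
  apply/eqP; rewrite -subr_eq0; apply/eqP.
  transitivity (1 - 2 * 'z - 3 * 'z ^+ 2 - (1 - 'z - 2 * 'z * u) ^+ 2 : fps rat).
    by ring.
  by rewrite eqs subrr.
move/fps_Z_lreg/fpsP=> equ; apply/fpsP=> n; have := equ n.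
by rewrite !coef_fpsMn => /eqP; rewrite Num.Theory.eqrMn2r // => /eqP.
Qed.

(* 0 <= i < n.+1 - k is the integer range 0 <= i <= n - k, empty for n < k. *)
Theorem proposition7 (n k : nat) :
  riordan_term (1 + 'z * motzkin) ('z * (1 + 'z * motzkin)) n k =
  if n == k then 1
  else k.+1%:R / (n%:R - k%:R) *
       \sum_(0 <= j < k.+1) 'C(k, j)%:R *
         \sum_(0 <= i < n.+1 - k)
           'C(n - k, i)%:R *
           (binz i (n%:Z - k%:Z - i%:Z - j%:Z - 1))%:R.
Proof.
set u := 'z * motzkin.
have u0 : u`[z^0] = 0 by rewrite coef_fpsZM.
have colE : riordan_term (1 + u) ('z * (1 + u)) n k =
    ('z ^+ k * fps_subst ((1 + 'X) ^+ k.+1) u)`[z^n].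
  rewrite /riordan_term /fps_subst; congr (fcoef _ _).
  rewrite rmorphXn rmorphD rmorph1 /= map_polyX.
  by rewrite !hornerE exprMn mulrCA -exprS.
rewrite {}colE coef_fpsZnM; case: (ltngtP n k) => [ltnk|ltkn|->].
- rewrite big1 ?mulr0 // => j _.
  have -> : (n.+1 - k = 0)%N by lia.
  by rewrite big_geq ?mulr0.
- have [m mE] : exists m, (n - k = m.+1)%N by exists (n - k).-1; lia.
  have phiE : u = 'z * fps_subst (1 + 'X + 'X ^+ 2) u.
    rewrite /fps_subst !rmorphD rmorphXn rmorph1 /= map_polyX !hornerE.
    exact: motzkin_quadratic.
  have dH : ((1 + 'X : {poly rat}) ^+ k.+1)^`() = (1 + 'X) ^+ k *+ k.+1.
    by rewrite deriv_exp derivD derivX derivC add0r mul1r.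
  have m0 : m.+1%:R != 0 :> rat by rewrite Num.Theory.pnatr_eq0.
  have -> : n%:R - k%:R = m.+1%:R :> rat by rewrite -natrB ?mE // ltnW.
  have -> : (n.+1 - k = m.+2)%N by lia.
  apply: (mulIf m0); rewrite mE mulr_natr.
  rewrite (lagrange_inversion rat _ ((1 + 'X) ^+ k.+1) u m phiE) dH.
  rewrite [in LHS]mulrnAl coefMn coef_add1X_trinomial mulrAC divfK // mulr_natl.
  congr (_ *+ _); apply: eq_bigr => j _; congr (_ * _).
  apply: eq_bigr => i _; congr (_ * _%:R); congr binz; lia.
- by rewrite subnn coef0_fps_subst // coef_add1X bin0.
Qed.
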